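(* Let $G$ be a countably infinite amenable cancellative semigroup. Let $(F_n)_{n\ge 1}$ be a F{\o}lner sequence in $G$ such that for every $\alpha\in(0,1)$ we have $\sum_{n=1}^\infty \alpha^{|F_n|}<\infty$. Then $\lambda$-almost every $x\in\{0,1\}^G$ is $(F_n)$-generic for $\lambda$, i.e., the convergence $$\lim_{n\to\infty}\frac1{|F_n|}\sum_{g\in F_n}f(\sigma_g x)=\int f\,d\lambda$$ holds for every continuous function $f$ on $\{0,1\}^G$.
   Context: A semigroup $G$ is (two-sided) cancellative if $ab=ac\Rightarrow b=c$ and $ba=ca\Rightarrow b=c$. For $g\in G$, $F\subset G$: $g^{-1}F=\{h\in G: gh\in F\}$. A sequence $(F_n)$ of (nonempty) finite subsets of $G$ is a (left) F{\o}lner sequence if $\lim_n |F_n\cap g^{-1}F_n|/|F_n|=1$ for every $g\in G$. Amenable means (left) amenable (for such $G$: a left F{\o}lner sequence exists). The semigroup $G$ acts on $\{0,1\}^G$ (product topology) by $\sigma_g(x)=(x_{hg})_{h\in G}$ for $x=(x_h)_{h\in G}$. $\lambda$ is the uniform product (Bernoulli) measure $(\frac12,\frac12)^G$ on $\{0,1\}^G$. *)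

(* Defs.v *)
From HB Require Import structures.
From mathcomp Require Import all_boot all_order all_algebra finmap monoid.
From mathcomp Require Import all_classical all_reals all_analysis.

Set Implicit Arguments.
Unset Strict Implicit.
Unset Printing Implicit Defensive.

Import Order.TTheory GRing.Theory Num.Theory.
Import numFieldNormedType.Exports.

Local Open Scope classical_set_scope.
Local Open Scope ring_scope.

Definition cancellative (G : semigroupType) : Prop :=
  (forall a b c : G, (a * b = a * c)%g -> b = c) /\
  (forall a b c : G, (b * a = c * a)%g -> b = c).

(** F_n `&` g^-1 F_n, where g^-1 F = {h | g h \in F} makes sense even when g
    has no inverse. *)
Definition folner_inter (G : semigroupType) (g : G) (A : {fset G}) : {fset G} :=
  [fset h in A | (g * h)%g \in A]%fset.

Definition is_folner (R : realType) (G : semigroupType) (F : nat -> {fset G}) :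
    Prop :=
  (forall n, F n != fset0) /\
  (forall g : G,
    (fun n => #|` folner_inter g (F n)|%:R / #|` F n|%:R : R) @ \oo
      --> (1 : R)).

Definition amenable (R : realType) (G : semigroupType) : Prop :=
  exists F : nat -> {fset G}, is_folner R F.

(** {0,1}^G with the product topology ([bool] being discrete), and the same
    set with its Borel sigma-algebra. *)
Notation config G := {ptws G -> bool}.
Notation borel_config G := (g_sigma_algebraType (@open (config G))).

Definition sigma_act (G : semigroupType) (g : G) (x : config G) : config G :=
  fun h => x (h * g)%g.

(** A product measure is determined by its values on the rectangles that
    constrain finitely many coordinates: for countable [G] these form a
    pi-system generating the Borel sigma-algebra. *)
Definition is_product_measure (R : realType) (G : choiceType)
    (mu : probability bool R) (lambda : probability (borel_config G) R) : Prop :=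
  forall (K : {fset G}) (A : G -> set bool),
    lambda [set x | forall g, g \in K -> A g (x g)] =
    (\prod_(g <- K) fine (mu (A g)))%:E.

Definition is_uniform_bernoulli (R : realType) (G : choiceType)
    (lambda : probability (borel_config G) R) : Prop :=
  is_product_measure (bernoulli_prob (2^-1 : R)) lambda.

Definition generic (R : realType) (G : semigroupType) (F : nat -> {fset G})
    (lambda : probability (borel_config G) R) (x : config G) : Prop :=
  forall f : config G -> R, continuous f ->
    (fun n => (#|` F n|%:R)^-1 * \sum_(g <- F n) f (sigma_act g x)) @ \oo -->
    (\int[lambda]_y f y : R).

(* Main.v *)
Require Import Defs.
From mathcomp Require Import all_boot all_order all_algebra finmap monoid.
From mathcomp Require Import all_classical all_reals all_analysis.
From mathcomp Require Import ring lra.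

Set Implicit Arguments.
Unset Strict Implicit.
Unset Printing Implicit Defensive.

Import Order.TTheory GRing.Theory Num.Theory.
Import numFieldNormedType.Exports.

Local Open Scope classical_set_scope.
Local Open Scope ring_scope.

(** The Walsh functions [walsh s x], the products of the signs (-1)^(x g) over g
    in a finite list s, reduce the theorem to a statement about one Walsh
    function at a time.  By compactness of {0,1}^G every continuous function is
    a uniform limit of functions of finitely many coordinates, and these are
    linear combinations of Walsh functions.  Both sides of the limit are linear
    in f and stable under uniform approximation, the constant 1 is trivial, and
    a Walsh function of a nonempty repetition-free s has integral 0; so a point
    x is generic as soon as the averages of each of these tend to 0 along x
    ([generic_of_walsh]).  As G is countable there are countably many of them,
    and it suffices to treat one s almost surely.

    Translating, [walsh s (sigma_act g x)] is the Walsh function of s g.  Right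
    cancellation keeps s g repetition-free; left cancellation implies that s g
    meets at most |s|^2 of the sets s h.  Hence F_n can be coloured greedily
    with N = |s|^2 + 1 colours so that the translates of one colour are
    pairwise disjoint.  For such a colour class C and a real a, the Riesz product
    prod_(g in C) (1 + a walsh (s g)) has integral exactly 1, because all other
    terms of its expansion are Walsh functions of nonempty sets
    ([integral_riesz]); and it is at least exp (a S - 2 a^2 |C|), where S is
    the sum of the Walsh functions over C ([riesz_ge]).  If the sum over F_n
    is at least N e |F_n| in absolute value, then some class has |S| >= e |F_n|, so
    one of its Riesz products with a = e/4 or a = -e/4 is at least
    exp (e^2/8 |F_n|).  Markov's inequality bounds the probability of the
    deviation by 2 N alpha^|F_n| with alpha = exp (-e^2/8) < 1
    ([walsh_deviation]).  This is summable by hypothesis, and the Borel-Cantelli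
    lemma concludes ([ae_walsh_average]). *)

(** * Continuous functions on the space of configurations *)

Lemma config_compact (G : choiceType) : compact [set: config G].
Proof.
have := @tychonoff G (fun=> bool) _ (fun=> bool_compact).
by congr (compact _); rewrite eqEsubset.
Qed.

Lemma config_coord_continuous (R : realType) (G : choiceType) (v : bool -> R)
    (g : G) :
  continuous (fun x : config G => v (x g)).
Proof.
move=> x; apply: (@continuous_comp _ _ _ (fun y : config G => y g) v).
  exact: (@proj_continuous G (fun=> bool) g).
move=> A /nbhs_singleton vA; apply: (filterS _ (discrete_set1 (x g))).
by move=> _ ->.
Qed.

Lemma continuous_prod (R : realType) (X : topologicalType) (I : Type)
    (s : seq I) (f : I -> X -> R) :
  (forall i, continuous (f i)) -> continuous (fun x => \prod_(i <- s) f i x).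
Proof. by move=> cf x; apply: (cvg_big mul_continuous) => i _; exact: cf. Qed.

Lemma continuous_sum (R : realType) (X : topologicalType) (I : Type)
    (s : seq I) (f : I -> X -> R) :
  (forall i, continuous (f i)) -> continuous (fun x => \sum_(i <- s) f i x).
Proof. by move=> cf x; apply: (cvg_big add_continuous) => i _; exact: cf. Qed.

(** Continuous functions are Borel by the choice of sigma-algebra and bounded by
    compactness. Every integrand below is continuous, so this settles all
    integrability questions. *)
Lemma continuous_integrable (R : realType) (G : choiceType)
    (P : probability (borel_config G) R) (f : config G -> R) :
  continuous f -> P.-integrable [set: borel_config G] (EFin \o f).
Proof.
move=> cf; apply: measurable_bounded_integrable => //.
- by rewrite -ge0_fin_numE ?fin_num_measure.
- apply: (measurability _ (measurable_realfun.RGenOpens.measurableE R)).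
  move=> _ [_ [a [b ->] <-]].
  rewrite setTI; apply: sub_sigma_algebra.
  by move/continuousP: cf; apply; exact: interval_open.
- have fT : compact (f @` [set: config G]).
    apply: continuous_compact; first exact: continuous_subspaceT.
    exact: config_compact.
  have [M [Mr fM]] := compact_bounded fT; exists M; split => // y My x _.
  by apply: (fM y My); exists x.
Qed.

Lemma integrable_scale d (T : measurableType d) (R : realType)
    (mu : {measure set T -> \bar R}) (D : set T) (a : R) (f : T -> R) :
  measurable D -> mu.-integrable D (EFin \o f) ->
  mu.-integrable D (EFin \o (fun x => a * f x)).
Proof. by move=> mD /(integrableZl mD a); exact: eq_integrable. Qed.

Lemma Rintegral_sum d (T : measurableType d) (R : realType)
    (mu : {measure set T -> \bar R}) (D : set T) (I : Type) (s : seq I)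
    (f : I -> T -> R) :
  measurable D -> (forall i, mu.-integrable D (EFin \o f i)) ->
  \int[mu]_(x in D) (\sum_(i <- s) f i x) =
  \sum_(i <- s) \int[mu]_(x in D) f i x.
Proof.
move=> mD intf; elim: s => [|i s IH].
  rewrite big_nil; under eq_Rintegral do rewrite big_nil.
  by rewrite /Rintegral integral0.
rewrite big_cons -IH -RintegralD //.
  by apply: eq_Rintegral => x _; rewrite big_cons.
have := @integrable_sum _ _ _ mu D mD _ s xpredT _ (fun i _ => intf i).
by apply: eq_integrable => // x _; rewrite /= sumEFin.
Qed.

Lemma integral_probability_cst d (T : measurableType d) (R : realType)
    (P : probability T R) (a : R) : \int[P]_x a = a.
Proof.
transitivity (a * fine (P [set: T])); first exact: Rintegral_cst.
by rewrite probability_setT mulr1.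
Qed.

Section borel_config_integrals.
Variables (R : realType) (G : choiceType).
Variable lambda : probability (borel_config G) R.

Lemma measurable_ge_continuous (f : config G -> R) (a : R) :
  continuous f -> measurable ([set x | a <= f x] : set (borel_config G)).
Proof.
move=> cf; rewrite -[X in measurable X]setCK; apply: measurableC.
apply: sub_sigma_algebra; rewrite -closedC setCK.
by apply: (closed_comp _ (@closed_ge _ a)) => x _; exact: cf.
Qed.

Lemma markov_continuous (f : config G -> R) (a : R) :
  0 < a -> continuous f -> (forall x, 0 <= f x) ->
  (lambda [set x | (a <= f x)%R] <= (a^-1 * \int[lambda]_x f x)%:E)%E.
Proof.
move=> a0 cf f0.
have intf := continuous_integrable lambda cf.
rewrite EFinM lee_pdivlMl // fineK; last exact: integrable_fin_num intf.
have mf := measurable_int _ intf.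
have := le_integral_comp_abse lambda measurableT (f := id) (a := a)
  (@measurable_id _ _ _) (fun r r0 => r0) (fun x y _ _ xy => xy) mf a0.
rewrite /= setTI.
have -> : [set x | (a%:E <= `|(f x)%:E|)%E] = [set x | a <= f x].
  by apply/seteqP; split => x; rewrite /= ger0_norm // lee_fin.
move=> /le_trans; apply.
by under eq_integral => x _ do rewrite /= ger0_norm //.
Qed.

End borel_config_integrals.

(** * Walsh functions and their integrals *)

Definition walsh (R : realType) (G : choiceType) (s : seq G) (x : config G) : R :=
  \prod_(g <- s) (-1) ^+ x g.

Lemma walsh_cat (R : realType) (G : choiceType) (s t : seq G) (x : config G) :
  walsh R (s ++ t) x = walsh R s x * walsh R t x.
Proof. exact: big_cat. Qed.

Lemma normr_walsh (R : realType) (G : choiceType) (s : seq G) (x : config G) :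
  `|walsh R s x| = 1.
Proof. by rewrite normr_prod big1 // => g _; rewrite normr_sign. Qed.

Lemma walsh_continuous (R : realType) (G : choiceType) (s : seq G) :
  continuous (@walsh R G s).
Proof.
apply: continuous_prod => g.
exact: (@config_coord_continuous R G (fun b => (-1) ^+ b) g).
Qed.

Lemma bernoulli_half_false (R : realType) :
  bernoulli_prob (2^-1 : R) [set false] = 2^-1%:E.
Proof.
rewrite /bernoulli_prob ifT; last by apply/andP; split; lra.
by rewrite fsbig_set1 /=; congr EFin; lra.
Qed.

Section bernoulli_integrals.
Variables (R : realType) (G : choiceType).
Variable lambda : probability (borel_config G) R.
Hypothesis hlambda : is_uniform_bernoulli lambda.

(** The integrand is the indicator of the cylinder on which all coordinates in K
    are 0. *)
Lemma integral_all_false (K : seq G) : uniq K ->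
  \int[lambda]_x (\prod_(g <- K) (~~ x g)%:R) = 2^-1 ^+ size K.
Proof.
move=> uK.
pose C : set (borel_config G) :=
  [set x | forall g, g \in [fset h in K]%fset -> [set false] (x g)].
have CE (x : borel_config G) : \prod_(g <- K) (~~ x g)%:R = \1_C x :> R.
  rewrite indicE; have [xC|xC] := boolP (x \in C).
    rewrite big_seq big1 // => g gK.
    by move/set_mem: xC => /(_ g); rewrite !inE /= => /(_ gK) ->.
  have [g gK xg] : exists2 g, g \in K & x g.
    apply/not_exists2P => all_false; move/negP: xC; apply; apply/mem_set => g.
    rewrite !inE /= => gK; apply/negbTE/negP => xg.
    by have [] := all_false g.
  by rewrite (big_rem g) //= xg mul0r.
have mC : measurable C.
  have -> : C = \big[setI/setT]_(g <- K) [set x | x g = false].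
    rewrite -bigcap_seq; apply/seteqP; split => x xC g; have:= xC g.
      by rewrite /= !inE.
    by rewrite /= !inE.
  apply: big_ind => //; first by move=> A B; exact: measurableI.
  move=> g _; apply: sub_sigma_algebra.
  have cg : continuous (fun x : config G => x g).
    exact: (@proj_continuous G (fun=> bool) g).
  have -> : [set x : config G | x g = false] =
      (fun x : config G => x g) @^-1` [set false] by [].
  by move/continuousP: cg; apply; exact: discrete_open.
rewrite /Rintegral (eq_integral (EFin \o \1_C)); last by move=> x _ /=; rewrite CE.
rewrite integral_indic // setIT.
rewrite (congr1 fine (hlambda [fset h in K]%fset (fun=> [set false]))).
rewrite /= bernoulli_half_false /=.
rewrite big_const_seq count_predT iter_mulr_1.
rewrite (perm_size (_ : perm_eq _ K)); last first.
  by apply: uniq_perm; [exact: fset_uniq|by []|move=> g; rewrite !inE].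
by [].
Qed.

(** The generalization of [integral_walsh] that makes the induction on s work:
    writing (-1)^b = 2 (~~ b) - 1 for the first sign moves its coordinate into the
    cylinder K, and the two resulting integrals cancel since adding one
    coordinate to K halves the measure. *)
Lemma integral_all_false_walsh (s K : seq G) : uniq (s ++ K) ->
  \int[lambda]_x (\prod_(g <- K) (~~ x g)%:R * walsh R s x) =
  2^-1 ^+ size K * (s == [::])%:R.
Proof.
elim: s K => [|g s IH] K usK.
  rewrite eqxx mulr1 -integral_all_false //; apply: eq_Rintegral => x _.
  by rewrite /walsh big_nil mulr1.
pose f K (x : borel_config G) := \prod_(g <- K) (~~ x g)%:R * walsh R s x.
have int_f L : lambda.-integrable setT (EFin \o f L).
  apply: continuous_integrable => x; apply: cvgM; last exact: walsh_continuous.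
  apply: continuous_prod => h.
  exact: (@config_coord_continuous R G (fun b => (~~ b)%:R) h).
have -> : \int[lambda]_x (\prod_(g0 <- K) (~~ x g0)%:R * walsh R (g :: s) x) =
    \int[lambda]_x (2 * f (g :: K) x - f K x).
  apply: eq_Rintegral => x _; rewrite /f /walsh !big_cons.
  by case: (x g); rewrite /= ?expr0 ?expr1; ring.
have ugK : uniq (s ++ g :: K).
  by rewrite -(cat1s g K) (perm_uniq (permEl (perm_catCA s [:: g] K))).
rewrite RintegralB //; last exact: integrable_scale.
rewrite RintegralZl // !IH //=; last by case/andP: usK.
by rewrite exprS; field.
Qed.

Lemma integral_walsh (s : seq G) : uniq s ->
  \int[lambda]_x walsh R s x = (s == [::])%:R.
Proof.
move=> us; rewrite -[RHS]mul1r -(@integral_all_false_walsh s [::]) ?cats0 //.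
by apply: eq_Rintegral => x _; rewrite big_nil mul1r.
Qed.

(** * Riesz products *)

Definition riesz (a : R) (C : seq (seq G)) (x : config G) : R :=
  \prod_(t <- C) (1 + a * walsh R t x).

Lemma riesz_continuous a C : continuous (riesz a C).
Proof.
apply: continuous_prod => t x; apply: cvgD; first exact: cvg_cst.
by apply: cvgM; [exact: cvg_cst|exact: walsh_continuous].
Qed.

(** The factor [walsh s] collects the terms of the expanded product: choosing
    a [walsh t] in the factor 1 + a [walsh t] replaces s by s ++ t, which is
    nonempty and still disjoint from the remaining lists, so that choice
    contributes nothing. *)
Lemma integral_walsh_riesz a (C : seq (seq G)) (s : seq G) :
  [::] \notin C -> uniq (s ++ flatten C) ->
  \int[lambda]_x (walsh R s x * riesz a C x) = (s == [::])%:R.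
Proof.
elim: C s => [|t C IH] s.
  rewrite cats0 => _ us; rewrite -integral_walsh //.
  by apply: eq_Rintegral => x _; rewrite /riesz big_nil mulr1.
rewrite inE negb_or => /andP[t0 C0] /= usC.
have int_f r :
    lambda.-integrable setT (EFin \o (fun x => walsh R r x * riesz a C x)).
  apply: continuous_integrable => x.
  by apply: cvgM; [exact: walsh_continuous|exact: riesz_continuous].
have -> : \int[lambda]_x (walsh R s x * riesz a (t :: C) x) =
    \int[lambda]_x (walsh R s x * riesz a C x +
      a * (walsh R (s ++ t) x * riesz a C x)).
  apply: eq_Rintegral => x _; rewrite /riesz big_cons walsh_cat; ring.
rewrite RintegralD //; last exact: integrable_scale.
have us : uniq (s ++ flatten C).
  move: usC; rewrite (perm_uniq (permEl (perm_catCA s t _))) cat_uniq.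
  by case/and3P.
rewrite RintegralZl // !IH -?catA //.
rewrite (_ : (s ++ t == [::]) = false) ?mulr0 ?addr0 //.
by case: s {usC us} => //=; rewrite eq_sym; apply/negbTE.
Qed.

Lemma integral_riesz a (C : seq (seq G)) :
  [::] \notin C -> uniq (flatten C) -> \int[lambda]_x riesz a C x = 1.
Proof.
move=> C0 uC; transitivity (([::] == [::] :> seq G)%:R : R); last by [].
rewrite -(@integral_walsh_riesz a C [::]) //.
by apply: eq_Rintegral => x _; rewrite /walsh big_nil mul1r.
Qed.

End bernoulli_integrals.

(** Taking inverses, this follows from exp u >= 1 + u at u = 2 y^2 - y, since
    (1 + y) (1 - y + 2 y^2) = 1 + y^2 (1 + 2 y). *)
Lemma expR_quadratic_le (R : realType) (y : R) :
  - 2^-1 <= y -> expR (y - 2 * y ^+ 2) <= 1 + y.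
Proof.
move=> y2.
have q0 : 0 < 1 + (2 * y ^+ 2 - y) by nra.
rewrite -(opprK (y - _)) expRN -[leRHS]invrK.
rewrite lef_pV2 ?posrE ?invr_gt0 ?expR_gt0//; last lra.
rewrite opprB; apply: le_trans (expR_ge1Dx _).
rewrite -[leLHS]mul1r ler_pdivrMr; last lra.
nra.
Qed.

(** Applies [expR_quadratic_le] to each factor; the quadratic terms are constant
    because Walsh functions take the values 1 and -1. *)
Lemma riesz_ge (R : realType) (G : choiceType) (a : R) (C : seq (seq G))
    (x : config G) :
  `|a| <= 2^-1 ->
  expR (a * (\sum_(t <- C) walsh R t x) - 2 * a ^+ 2 * (size C)%:R) <=
  riesz a C x.
Proof.
move=> a2; elim: C => [|t C IH].
  by rewrite /riesz !big_nil !mulr0 subrr expR0.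
rewrite /riesz !big_cons /= -/(riesz a C x).
have w2 : walsh R t x ^+ 2 = 1.
  by rewrite -real_normK ?num_real // normr_walsh expr1n.
have -> : a * (walsh R t x + \sum_(j <- C) walsh R j x) -
      2 * a ^+ 2 * (size C).+1%:R =
     (a * walsh R t x - 2 * (a * walsh R t x) ^+ 2) +
     (a * (\sum_(j <- C) walsh R j x) - 2 * a ^+ 2 * (size C)%:R).
  by rewrite exprMn w2 -natr1; ring.
rewrite expRD; apply: ler_pM; rewrite ?expR_ge0 //.
apply: expR_quadratic_le.
have : `|a * walsh R t x| <= 2^-1 by rewrite normrM normr_walsh mulr1.
by rewrite ler_norml => /andP[].
Qed.

(** * Colouring the translates of a finite set *)

(** Colouring the vertices one after the other, at most d of the d + 1 colours are
    forbidden at each step. *)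
Lemma greedy_colouring (T : eqType) (e : rel T) (d : nat) (s : seq T) :
  symmetric e -> {in s, forall x, (count (e x) s <= d)%N} ->
  exists c : T -> 'I_d.+1, {in s &, forall x y, x != y -> e x y -> c x != c y}.
Proof.
move=> e_sym; elim: s => [|x s IH] deg; first by exists (fun=> ord0).
have [|c cP] := IH.
  move=> y ys; apply: leq_trans (deg y _); last by rewrite inE ys orbT.
  by rewrite /= leq_addl.
pose used := [seq c y | y <- s & e x y].
have /existsP[j j_free] : [exists j, j \notin used].
  rewrite -negb_forall; apply/negP => /forallP all_used.
  have : (size (enum 'I_d.+1) <= size used)%N.
    by apply: uniq_leq_size (enum_uniq _) _ => j _; exact: all_used.
  rewrite size_enum_ord size_map size_filter leqNgt ltnS => /negP; apply.
  apply: leq_trans (deg x _); last by rewrite mem_head.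
  by rewrite /= leq_addl.
have fresh y : y \in s -> e x y -> c y != j.
  move=> ys xy; apply: contra j_free => /eqP <-.
  by apply: map_f; rewrite mem_filter xy.
exists (fun y => if y == x then j else c y) => y z; rewrite !inE.
have [->|yx] := eqVneq y x; have [->|zx] := eqVneq z x; rewrite ?eqxx //=.
- by move=> _ zs _ xz; rewrite eq_sym fresh.
- by move=> ys _ _; rewrite e_sym; exact: fresh.
- exact: cP.
Qed.

Lemma count_has_leq (S T : Type) (p : S -> pred T) (r : seq S) (s : seq T) :
  (count (fun y => has (p^~ y) r) s <= \sum_(z <- r) count (p z) s)%N.
Proof.
elim: r => [|z r IH]; first by rewrite count_pred0.
rewrite big_cons; apply: leq_trans (leq_add (leqnn _) IH).
by rewrite -count_predUI leq_addr.
Qed.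

Definition translate (G : semigroupType) (K : seq G) (g : G) : seq G :=
  [seq (k * g)%g | k <- K].

Lemma walsh_sigma_act (R : realType) (G : semigroupType) (K : seq G) (g : G)
    (x : config G) :
  walsh R K (sigma_act g x) = walsh R (translate K g) x.
Proof. by rewrite /walsh big_map. Qed.

Definition overlap (G : semigroupType) (K : seq G) : rel G :=
  fun g h => has (mem (translate K g)) (translate K h).

Lemma overlap_sym (G : semigroupType) (K : seq G) : symmetric (overlap K).
Proof. by move=> g h; rewrite /overlap has_sym. Qed.

(** For each k and l in K, left cancellation leaves at most one h with k h = l g. *)
Lemma overlap_degree (G : semigroupType) (K F : seq G) (g : G) :
  cancellative G -> uniq F -> (count (overlap K g) F <= size K ^ 2)%N.
Proof.
move=> [mulI _] uF.
pose p (z : G * G) := [pred h | (z.1 * h)%g == (z.2 * g)%g].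
rewrite (eq_count (a2 := fun h => has (p^~ h) [seq (k, l) | k <- K, l <- K])).
  apply: leq_trans (count_has_leq _ _ _) _.
  rewrite -mulnn -(size_allpairs pair K K) -sum1_size; apply: leq_sum => z _.
  rewrite (eq_count (a2 := preim (fun h => z.1 * h)%g (pred1 (z.2 * g)%g))) //.
  rewrite -count_map count_uniq_mem ?leq_b1 // map_inj_uniq //.
  by move=> h h'; exact: mulI.
move=> h; apply/hasP/hasP => [[_ /mapP[k kK ->] /mapP[l lK kl]]|[[k l]]].
  by exists (k, l); [exact: allpairs_f|apply/eqP].
move=> /allpairsP[[k' l'] /= [kK lK [-> ->]]] /eqP /= kl.
by exists (k' * h)%g; [exact: map_f|apply/mapP; exists l'].
Qed.

(** A repetition within one translate is excluded by right cancellation, a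
    repetition between two translates by the hypothesis on C. *)
Lemma uniq_translates (G : semigroupType) (K C : seq G) :
  cancellative G -> uniq K -> uniq C ->
  {in C &, forall g h, g != h -> ~~ overlap K g h} ->
  uniq (flatten [seq translate K g | g <- C]).
Proof.
move=> [_ mulI] uK uC indep; apply: allpairs_uniq => //.
move=> _ _ /allpairsP[[g k] /= [gC kK ->]] /allpairsP[[h l] /= [hC lK ->]] /= kl.
have gh : g = h.
  apply/eqP; apply: contraT => /(indep _ _ gC hC)/negP; case.
  by apply/hasP; exists (l * h)%g; [exact: map_f|rewrite /= -kl; exact: map_f].
by rewrite gh in kl *; rewrite (mulI _ _ _ kl).
Qed.

(** * Deviation of the averages of a Walsh function *)

Section deviation.
Variables (R : realType) (G : semigroupType).
Variable lambda : probability (borel_config G) R.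
Hypothesis hlambda : is_uniform_bernoulli lambda.
Hypothesis hcanc : cancellative G.

Lemma measurable_walsh_deviation (K F : seq G) (a : R) :
  measurable ([set x | a <= `|\sum_(g <- F) walsh R K (sigma_act g x)|]
    : set (borel_config G)).
Proof.
apply: measurable_ge_continuous => x; apply: cvg_norm.
apply: continuous_sum => g {}x.
have -> : (fun y => walsh R K (sigma_act g y)) = walsh R (translate K g).
  by apply/funext => y; exact: walsh_sigma_act.
exact: walsh_continuous.
Qed.

(** Markov's inequality is applied once, to the sum Z of the 2 N Riesz products
    attached to the N colours and the two signs: Z has integral 2 N, and a large
    deviation makes one of its nonnegative terms large. *)
Lemma walsh_deviation (K F : seq G) (e : R) :
  uniq K -> K != [::] -> uniq F -> 0 < e <= 2 ->
  (lambda [set x | ((size K ^ 2).+1%:R * e * (size F)%:R <=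
       `|\sum_(g <- F) walsh R K (sigma_act g x)|)%R] <=
   (expR (- (e ^+ 2 / 8)) ^+ size F * (2 * (size K ^ 2).+1%:R))%:E)%E.
Proof.
move=> uK K0 uF /andP[e0 e2]; set N := (size K ^ 2).+1; set n := size F.
have [c cP] : exists c : G -> 'I_N,
    {in F &, forall g h, g != h -> overlap K g h -> c g != c h}.
  apply: greedy_colouring; first exact: overlap_sym.
  by move=> g _; exact: overlap_degree.
pose C j := [seq translate K g | g <- F & c g == j].
have C0 j : [::] \notin C j.
  apply/negP => /mapP[g _ /(congr1 size)]; rewrite size_map /=.
  by move/esym/size0nil/eqP; rewrite (negbTE K0).
have uC j : uniq (flatten (C j)).
  apply: uniq_translates; rewrite ?filter_uniq // => g h.
  rewrite !mem_filter => /andP[/eqP gj gF] /andP[/eqP hj hF] gh.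
  by apply/negP => /(cP _ _ gF hF gh); rewrite gj hj eqxx.
have sumC x : \sum_(g <- F) walsh R K (sigma_act g x) =
    \sum_j \sum_(t <- C j) walsh R t x.
  rewrite (partition_big c xpredT) //=; apply: eq_bigr => j _.
  by rewrite big_map big_filter; apply: eq_bigr => g _; rewrite walsh_sigma_act.
(* s = e / 4 maximizes s e - 2 s^2, with maximum e^2 / 8. *)
pose s : R := e / 4.
have s2 : `|s| <= 2^-1 by rewrite ger0_norm /s; lra.
pose Z (x : config G) : R :=
  \sum_(j < N) (riesz s (C j) x + riesz (- s) (C j) x).
have riesz0 j x (b : R) : `|b| <= 2^-1 -> 0 <= riesz b (C j) x.
  by move=> b2; apply: le_trans (riesz_ge _ _ b2); exact: expR_ge0.
have Z0 x : 0 <= Z x by apply: sumr_ge0 => j _; rewrite addr_ge0 ?riesz0 ?normrN.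
have cZj j : continuous (fun x => riesz s (C j) x + riesz (- s) (C j) x).
  by move=> x; apply: cvgD; exact: riesz_continuous.
have cZ : continuous Z by exact: continuous_sum.
have intZ : \int[lambda]_x Z x = 2 * N%:R.
  rewrite Rintegral_sum //; last by move=> j; exact: continuous_integrable.
  under eq_bigr => j _.
    rewrite RintegralD //;
      try by apply: continuous_integrable; exact: riesz_continuous.
    rewrite !integral_riesz //; over.
  by rewrite sumr_const card_ord mulr_natr.
rewrite -intZ -(invrK (expR _ ^+ _)).
apply: le_trans (markov_continuous lambda _ cZ Z0); last first.
  by rewrite invr_gt0 exprn_gt0 ?expR_gt0.
apply: le_measure; rewrite ?inE.
- exact: measurable_walsh_deviation.
- exact: measurable_ge_continuous.
move=> x /= dev.
have [j jdev] : exists j, e * n%:R <= `|\sum_(t <- C j) walsh R t x|.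
  apply: contrapT => /forallNP small; move: dev; apply/negP; rewrite -ltNge sumC.
  apply: le_lt_trans (ler_norm_sum _ _ _) _.
  rewrite -mulrA -[N in N%:R * _]card_ord mulr_natl -sumr_const.
  apply: ltr_sum => [|j _]; last by rewrite ltNge; exact/negP.
  by apply/hasP; exists ord0; rewrite ?mem_index_enum.
have [b [bs bdev]] : exists b : R, (b = s \/ b = - s) /\
    s * e * n%:R <= b * \sum_(t <- C j) walsh R t x.
  have s0 : 0 <= s by rewrite /s; lra.
  move: jdev; rewrite ler_normr => /orP[jdev|jdev]; [exists s|exists (- s)].
    by split; [left|rewrite -mulrA ler_wpM2l].
  by split; [right|rewrite -mulrA mulNr -mulrN ler_wpM2l].
have b2 : `|b| <= 2^-1 by case: bs => ->; rewrite ?normrN.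
apply: (@le_trans _ _ (riesz b (C j) x)).
  apply: le_trans (riesz_ge _ _ b2).
  rewrite -expRM_natl -expRN ler_expR.
  have sq : b ^+ 2 = s ^+ 2 by case: bs => ->; rewrite ?sqrrN.
  have sC : (size (C j))%:R <= n%:R :> R.
    by rewrite ler_nat size_map size_filter count_size.
  rewrite sq /s in bdev *.
  nra.
rewrite /Z (bigD1 j) //=.
apply: le_trans (_ : _ <= riesz s (C j) x + riesz (- s) (C j) x) _.
  by case: bs => ->; rewrite ?lerDl ?lerDr riesz0 ?normrN.
by rewrite lerDl sumr_ge0 // => i _; rewrite addr_ge0 ?riesz0 ?normrN.
Qed.

End deviation.

(** * Uniform approximation by functions of finitely many coordinates *)

Definition agree (G : choiceType) (K : seq G) (x y : config G) : Prop :=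
  forall g, g \in K -> x g = y g.

(** The filter generated by the cylinders around x converges to x, since it does
    so in each coordinate. *)
Lemma nbhs_cylinder (G : choiceType) (x : config G) (U : set (config G)) :
  nbhs x U -> exists K : seq G, agree K x `<=` U.
Proof.
pose cyl := filter_from [set: seq G] (fun K => agree K x).
have cyl_filter : Filter cyl.
  apply: filter_from_filter; first by exists [::].
  move=> K L _ _; exists (K ++ L) => // y xy.
  by split=> g gK; apply: xy; rewrite mem_cat gK ?orbT.
have : cyl --> x.
  apply/cvg_sup => g V [_ [[W oW <-] Wx WV]].
  exists [:: g] => // y xy; apply: WV => /=.
  by rewrite -(xy g) ?inE.
by move=> /[apply] -[K _ KU]; exists K.
Qed.

Lemma nbhs_agree (G : choiceType) (K : seq G) (x : config G) :
  nbhs x (agree K x).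
Proof.
elim: K => [|g K IH]; first by apply: filterS filterT => y _ g.
have xg : nbhs x [set y : config G | y g = x g].
  exact: (@proj_continuous G (fun=> bool) g x _ (discrete_set1 (x g))).
by apply: filterS2 IH xg => y xy yg h; rewrite inE => /predU1P[->|/xy].
Qed.

(** At each point x continuity provides a finite K that works for all points near x;
    larger lists work as well, so compactness, in its near-covering form for the
    filter of lists containing a given one, yields a K that works everywhere. *)
Lemma uniform_cylinder (R : realType) (G : choiceType) (f : config G -> R)
    (e : R) :
  continuous f -> 0 < e ->
  exists K : seq G, forall x y, agree K x y -> `|f x - f y| < e.
Proof.
move=> cf e0.
pose above :=
  filter_from [set: seq G] (fun K => [set L : seq G | {subset K <= L}]).
have above_filter : Filter above.
  apply: filter_from_filter; first by exists [::].
  move=> K L _ _; exists (K ++ L) => // M KLM.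
  by split=> g gK; apply: KLM; rewrite mem_cat gK ?orbT.
pose P (K : seq G) (x : config G) := forall y, agree K x y -> `|f x - f y| < e.
have /compact_near_coveringP/(_ _ above P above_filter) := @config_compact G.
have /[swap] /[apply] : forall x, [set: config G] x ->
    \forall x' \near x & K \near above, P K x'.
  move=> x _.
  have /cvgrPdist_lt/(_ (e / 2)) := cf x.
  rewrite divr_gt0 // => /(_ isT)/nbhs_cylinder[K Kx].
  exists (agree K x, [set L : seq G | {subset K <= L}]) => /=.
    by split; [exact: nbhs_agree|exists K].
  move=> [y L] /= [xy KL] z yz.
  have xz : agree K x z by move=> g gK; rewrite xy // yz // KL.
  rewrite -(subrKA (f x)) (splitr e) (le_lt_trans (ler_normD _ _)) // distrC.
  by rewrite ltrD // Kx.
by move=> [K _ KP]; exists K => x y; apply: KP.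
Qed.

(** * Generic points *)

Section generic_points.
Variables (R : realType) (G : semigroupType) (F : nat -> {fset G}).
Variable lambda : probability (borel_config G) R.
Hypothesis F0 : forall n, F n != fset0.

Definition average (f : config G -> R) (x : config G) (n : nat) : R :=
  (#|` F n|%:R)^-1 * \sum_(g <- F n) f (sigma_act g x).

Lemma averageD (f h : config G -> R) x n :
  average (fun y => f y + h y) x n = average f x n + average h x n.
Proof. by rewrite /average big_split mulrDr. Qed.

Lemma averageZ a (f : config G -> R) x n :
  average (fun y => a * f y) x n = a * average f x n.
Proof. by rewrite /average -mulr_sumr mulrCA. Qed.

Lemma card_F_gt0 n : 0 < (#|` F n|%:R : R).
Proof. by rewrite ltr0n cardfs_gt0. Qed.

Lemma average_cst a x n : average (fun=> a) x n = a.
Proof.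
rewrite /average big_const_seq count_predT iter_addr_0 -(mulr_natl a) mulKf //.
by rewrite gt_eqF // card_F_gt0.
Qed.

Lemma average_dist (f h : config G -> R) (e : R) x n :
  (forall y, `|f y - h y| <= e) -> `|average f x n - average h x n| <= e.
Proof.
move=> fh; rewrite -[leRHS](average_cst e x n) /average -mulrBr -sumrB normrM.
rewrite ger0_norm ?invr_ge0 ?ler0n // ler_wpM2l ?invr_ge0 ?ler0n //.
by apply: le_trans (ler_norm_sum _ _ _) _; apply: ler_sum.
Qed.

(** Integrability is part of the notion because the integral is additive only on
    integrable functions. *)
Definition equidistributes (x : config G) (f : config G -> R) : Prop :=
  lambda.-integrable [set: borel_config G] (EFin \o f) /\
  average f x @ \oo --> \int[lambda]_y f y.

Lemma equidistributesD x f h : equidistributes x f -> equidistributes x h ->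
  equidistributes x (fun y => f y + h y).
Proof.
move=> [intf cf] [inth ch]; split.
  by have := integrableD measurableT intf inth; apply: eq_integrable.
rewrite RintegralD //; under [X in X @ _ --> _]funext do rewrite averageD.
exact: cvgD.
Qed.

Lemma equidistributesZ x a f : equidistributes x f ->
  equidistributes x (fun y => a * f y).
Proof.
move=> [intf cf]; split; first exact: integrable_scale.
rewrite RintegralZl //; under [X in X @ _ --> _]funext do rewrite averageZ.
by apply: cvgM => //; exact: cvg_cst.
Qed.

Lemma equidistributes_limit x f :
  continuous f ->
  (forall e, 0 < e ->
    exists2 h, equidistributes x h & forall y, `|f y - h y| <= e) ->
  average f x @ \oo --> \int[lambda]_y f y.
Proof.
move=> cf approx; apply/cvgrPdist_lt => e e0.
have [|h [inth ch] fh] := approx (e / 3); first by rewrite divr_gt0.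
have intf := continuous_integrable lambda cf.
have int_fh : `|\int[lambda]_y f y - \int[lambda]_y h y| <= e / 3.
  rewrite -RintegralB //; apply: le_trans (le_normr_Rintegral _ _) _ => //.
    by have := integrableB measurableT intf inth; apply: eq_integrable.
  have <- : \int[lambda]_y (e / 3) = e / 3.
    exact: integral_probability_cst.
  apply: le_Rintegral => //.
    apply: integrable_norm.
    by have := integrableB measurableT intf inth; apply: eq_integrable.
  by apply: continuous_integrable; exact: cst_continuous.
move/cvgrPdist_lt : ch => /(_ (e / 3)); rewrite divr_gt0 // => /(_ isT).
apply: filterS => n hn.
have := average_dist x n fh.
move: hn int_fh; rewrite ltr_norml !ler_norml.
move=> /andP[h1 h2] /andP[h3 h4] /andP[h5 h6].
by rewrite ltr_norml; apply/andP; split; lra.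
Qed.

Definition truncate (K : seq G) (x : config G) : config G :=
  fun g => (g \in K) && x g.

Hypothesis hlambda : is_uniform_bernoulli lambda.

(** Splits off one coordinate g of K at a time: a function of x restricted to g :: K
    is the sum of its even part in x g and of (-1)^(x g) times its odd part, both
    of which depend on x only through K. The sign is absorbed into the Walsh
    factor, which is why that factor is part of the statement. *)
Lemma equidistributes_cylinder x (K M : seq G) (f : config G -> R) :
  (forall s, uniq s -> s != [::] -> average (@walsh R G s) x @ \oo --> 0) ->
  uniq (K ++ M) ->
  equidistributes x (fun y => walsh R M y * f (truncate K y)).
Proof.
move=> avg0.
have eqd_walsh s : uniq s -> equidistributes x (@walsh R G s).
  move=> us; split; first by apply: continuous_integrable; exact: walsh_continuous.
  rewrite (integral_walsh hlambda) //; case: s us => [|g s] us; last exact: avg0.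
  rewrite (_ : walsh R [::] = fun=> 1).
    under [X in X @ _ --> _]funext do rewrite average_cst.
    exact: cvg_cst.
  by apply/funext => y; rewrite /walsh big_nil.
elim: K M f => [|g K IH] M f uKM.
  rewrite (_ : (fun y => _) = (fun y => f (fun=> false) * walsh R M y)).
    by apply: equidistributesZ; exact: eqd_walsh.
  by apply/funext => y; rewrite mulrC.
pose upd (z : config G) b : config G := fun h => if h == g then b else z h.
pose even_part z := 2^-1 * (f (upd z false) + f (upd z true)).
pose odd_part z := 2^-1 * (f (upd z false) - f (upd z true)).
rewrite (_ : (fun y => _) = (fun y => walsh R M y * even_part (truncate K y) +
    walsh R (g :: M) y * odd_part (truncate K y))).
  apply: equidistributesD.
    by apply: (IH M even_part); case/andP: uKM.
  apply: (IH (g :: M) odd_part).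
  by rewrite -(cat1s g M) (perm_uniq (permEl (perm_catCA K [:: g] M))).
apply/funext => y; rewrite /walsh big_cons.
have -> : truncate (g :: K) y = upd (truncate K y) (y g).
  by apply/funext => h; rewrite /truncate /upd inE; case: eqVneq => // ->.
by rewrite /even_part /odd_part; case: (y g); rewrite ?expr0 ?expr1; field.
Qed.

Lemma generic_of_walsh x :
  (forall s, uniq s -> s != [::] -> average (@walsh R G s) x @ \oo --> 0) ->
  generic F lambda x.
Proof.
move=> avg0 f cf; suff : average f x @ \oo --> \int[lambda]_y f y by [].
apply: equidistributes_limit => // e e0.
have [K Kf] := uniform_cylinder cf e0.
exists (fun y => walsh R [::] y * f (truncate (undup K) y)).
  by apply: equidistributes_cylinder => //; rewrite cats0 undup_uniq.
move=> y; rewrite /walsh big_nil mul1r ltW // Kf // => g gK.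
by rewrite /truncate mem_undup gK.
Qed.

End generic_points.

(** * Almost sure convergence *)

Lemma ae_forall_injective d (T : measurableType d) (R : realType)
    (mu : {measure set T -> \bar R}) (I : Type) (code : I -> nat)
    (P : I -> T -> Prop) :
  injective code -> (forall i, {ae mu, forall x, P i x}) ->
  {ae mu, forall x, forall i, P i x}.
Proof.
move=> code_inj aeP.
have : {ae mu, forall x, forall n i, code i = n -> P i x}.
  apply: ae_foralln => n; have [[i in_]|no_i] := pselect (exists i, code i = n).
    by apply: filterS (aeP i) => x Px j; rewrite -in_ => /code_inj ->.
  by apply: aeW => x i in_; case: no_i; exists i.
by apply: filterS => x Px i; exact: Px.
Qed.

Lemma seq_countable (T : Type) :
  countable [set: T] -> exists code : seq T -> nat, injective code.
Proof.
move=> /countable_injP[f f_inj]; exists (fun s => choice.pickle (map f s)).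
have f_inj' : injective f by move=> x y; apply: f_inj; rewrite inE.
by move=> s t /(pcan_inj choice.pickleK)/(inj_map f_inj').
Qed.

Lemma borel_cantelli_summable d (T : measurableType d) (R : realType)
    (mu : {measure set T -> \bar R}) (E : nat -> set T) (u : nat -> R) :
  (forall n, measurable (E n)) -> (forall n, (mu (E n) <= (u n)%:E)%E) ->
  cvgn (series u) -> {ae mu, forall x, \forall n \near \oo, ~ E n x}.
Proof.
move=> mE Eu cu.
have E0 : mu (lim_sup_set E) = 0%E.
  apply: lim_sup_set_cvg0 => //.
  apply: (@le_lt_trans _ _ (\sum_(n <oo) (u n)%:E)%E).
    by apply: lee_nneseries.
  rewrite (_ : (fun n => _) = EFin \o series u).
    by rewrite EFin_lim // ltry.
  by apply/funext => n; rewrite /= sumEFin.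
exists (lim_sup_set E); split => //.
  by apply: bigcap_measurable => // k _; exact: bigcup_measurable.
move=> x nE n _; apply: contrapT => nEn; apply: nE; exists n => // j nj Ej.
by apply: nEn; exists j.
Qed.

Lemma ae_walsh_average (R : realType) (G : semigroupType)
    (lambda : probability (borel_config G) R) (F : nat -> {fset G}) (s : seq G) :
  is_uniform_bernoulli lambda -> cancellative G -> (forall n, F n != fset0) ->
  (forall a : R, 0 < a < 1 -> cvgn (series (fun n => a ^+ #|` F n|))) ->
  uniq s -> s != [::] ->
  {ae lambda, forall x : borel_config G, average F (@walsh R G s) x @ \oo --> 0}.
Proof.
move=> hlambda hcanc F0 hsum us s0.
suff : {ae lambda, forall x : borel_config G,
    forall k, \forall n \near \oo, `|average F (@walsh R G s) x n| < k.+1%:R^-1}.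
  apply: filterS => x small; apply/cvgr0Pnorm_lt => e e0.
  have [k _ /(_ k (leqnn k)) ke] := near_infty_natSinv_lt (PosNum e0).
  by apply: filterS (small k) => n /lt_trans; apply.
apply: ae_foralln => k.
pose N := (size s ^ 2).+1.
(* Chosen so that the deviation threshold N e is 1 / (k + 1). *)
pose e : R := (k.+1%:R * N%:R)^-1.
have e0 : 0 < e by rewrite invr_gt0 mulr_gt0 ?ltr0n.
have e2 : e <= 2.
  apply: (@le_trans _ _ 1); last lra.
  by rewrite invf_le1 ?mulr_gt0 ?ltr0n // -natrM ler1n muln_gt0.
have Ne : N%:R * e = k.+1%:R^-1.
  by rewrite /e invfM mulrCA divff ?mulr1 ?pnatr_eq0.
pose a := expR (- (e ^+ 2 / 8)).
have a01 : 0 < a < 1 by rewrite expR_gt0 expR_lt1 oppr_lt0 divr_gt0 ?exprn_gt0.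
pose E n : set (borel_config G) := [set x | N%:R * e * #|` F n|%:R <=
   `|\sum_(g <- F n) walsh R s (sigma_act g x)|].
have mE n : measurable (E n).
  exact: measurable_walsh_deviation.
have cu : cvgn (series (fun n => a ^+ #|` F n| * (2 * N%:R))).
  rewrite (_ : (fun n => _) = (2 * N%:R) *: (fun n => a ^+ #|` F n|)).
    exact: is_cvg_seriesZ (hsum _ a01).
  by apply/funext => n; rewrite mulrC.
have Eu n : (lambda (E n) <= (a ^+ #|` F n| * (2 * N%:R))%:E)%E.
  by apply: walsh_deviation; rewrite ?fset_uniq ?e0.
apply: filterS (borel_cantelli_summable mE Eu cu) => x; apply: filterS => n /negP.
rewrite -ltNge /average normrM => small.
rewrite ger0_norm ?invr_ge0 ?ler0n // ltr_pdivrMl ?card_F_gt0 //.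
apply: lt_le_trans small _.
by rewrite Ne mulrC.
Qed.

Theorem theorem4p4 (R : realType) (G : semigroupType)
    (lambda : probability (borel_config G) R) (F : nat -> {fset G})
    (hcount : countable [set: G]) (hinf : infinite_set [set: G])
    (hcanc : cancellative G) (hamen : amenable R G)
    (hlambda : is_uniform_bernoulli lambda)
    (hF : is_folner R F)
    (hsum : forall alpha : R, 0 < alpha < 1 ->
       cvgn (series (fun n => alpha ^+ #|` F n|))) :
  {ae lambda, forall x, generic F lambda x}.
Proof.
have [F0 _] := hF; have [code code_inj] := seq_countable hcount.
have : {ae lambda, forall x : borel_config G, forall s : seq G,
    uniq s -> s != [::] -> average F (@walsh R G s) x @ \oo --> 0}.
  apply: (ae_forall_injective code_inj) => s.
  have [us|nus] := boolP (uniq s); last by apply: aeW => x.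
  have [->|s0] := eqVneq s [::]; first by apply: aeW => x.
  have := ae_walsh_average hlambda hcanc F0 hsum us s0.
  by apply: filterS => x avg _ _.
apply: (@filterS (borel_config G)) => x; exact: generic_of_walsh.
Qed.
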